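(* Let $E=\mathbb{R}$ and let $\varrho=((\rho_t^x)_{t\in\mathbb{N}_0})_{x\in\mathbb{R}}$ be a family of dynamic conditional risk mappings satisfying the Markov property. If $\varrho$ is time consistent then, for each bounded measurable function $g:\mathbb{R}\to\mathbb{R}$, the extended value functions $$\tilde V^T(x,m):=\inf_{\tau\in\mathscr{T}_{[0,T]}}\rho^{x,m}(g(M_T-X_\tau)),\qquad T\in\mathbb{N}_0,\ x,m\in\mathbb{R},$$ satisfy the modified Wald–Bellman equations $$\tilde V^0(x,m)=g(m-x),$$ $$\tilde V^n(x,m)=\rho^{x,m}(g(M_n-x))\wedge\rho^{x,m}\big(\tilde V^{n-1}(X_1,M_1)\big),\qquad n\ge1.$$ Moreover the optimal prediction problem $$V_{\mathrm{pred}}^n(x):=\inf_{\tau\in\mathscr{T}_{[0,n]}}\rho^x(g(X_n^*-X_\tau))$$ satisfies $V_{\mathrm{pred}}^n(x)=\tilde V^n(x,x)$.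
   Context: Setting. $E=\mathbb{R}$ with Borel $\sigma$-algebra $\mathcal{E}$; $\mathbb{N}_0=\{0,1,2,\ldots\}$; $\Omega=\mathbb{R}^{\mathbb{N}_0}$; $X_t(\omega)=\omega(t)$ is the coordinate process; $\mathcal{F}_t=\sigma(X_s: s\le t)$ and $\mathcal{F}=\sigma(\bigcup_t\mathcal{F}_t)$. $X$ is a time-homogeneous Markov chain; $x\mapsto\mathbb{P}^x$ is a measurable map from $E$ to the probability measures on $(\Omega,\mathcal{F})$, where $\mathbb{P}^x$ is the law of the chain started at $x$ (so $\mathbb{P}^x(X_0=x)=1$); its transition kernel is $q^X(B\vert x)=\mathbb{P}^x(X_1\in B)$. The shifts $\theta_t:\Omega\to\Omega$ satisfy $X_s\circ\theta_t=X_{t+s}$. $b\mathcal{G}$ denotes the bounded $\mathcal{G}$-measurable real random variables. $X_n^*:=\max_{0\le s\le n}X_s$. $\mathscr{T}_{[0,T]}$ is the set of stopping times with values in $\{0,\ldots,T\}$ (with respect to $(\mathcal{F}_t)$ in the definition of $V_{\mathrm{pred}}$, and with respect to the extended filtration $(\tilde{\mathcal{F}}_t)$ below in the definition of $\tilde V$). Risk mapping on $(\Omega,\mathcal{F},\mathbb{P}^x)$: a function $\rho^x:b\mathcal{F}\to\mathbb{R}$ with $\rho^x(0)=0$; $\rho^x(Z+c)=c+\rho^x(Z)$ for $Z\in b\mathcal{F}$, $c\in\mathbb{R}$; and $Z\le Z'$ $\mathbb{P}^x$-a.s. implies $\rho^x(Z)\le\rho^x(Z')$. Conditional risk mapping on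 $(\Omega,\mathcal{F},\mathbb{P}^x)$ with respect to $\mathcal{F}_t$: a function $\rho^x_t:b\mathcal{F}\to b\mathcal{F}_t$ with $\rho_t^x(0)=0$ $\mathbb{P}^x$-a.s.; $\rho_t^x(Z+Z')=Z'+\rho_t^x(Z)$ $\mathbb{P}^x$-a.s. for $Z\in b\mathcal{F}$, $Z'\in b\mathcal{F}_t$; and $Z\le Z'$ $\mathbb{P}^x$-a.s. implies $\rho_t^x(Z)\le\rho_t^x(Z')$ $\mathbb{P}^x$-a.s. Dynamic conditional risk mapping on $(\Omega,\mathcal{F},(\mathcal{F}_t),\mathbb{P}^x)$: a sequence $(\rho_t^x)_{t\in\mathbb{N}_0}$ where $\rho_0^x$ is a risk mapping and, for $t\ge1$, $\rho_t^x$ is a conditional risk mapping with respect to $\mathcal{F}_t$. A family of dynamic conditional risk mappings consists of one such sequence for each $x\in E$. Write $\rho^x:=\rho_0^x$. Regularity: $(\rho^x)_{x\in E}$ is regular if for all $Z\in b\mathcal{F}$ the map $x\mapsto\rho^x(Z)$ is bounded and measurable. Markov property: $\varrho$ satisfies the Markov property if $(\rho^x_0)_{x\in E}$ is regular and for each $x\in E$, $Z\in b\mathcal{F}$, $t\in\mathbb{N}_0$: $\rho_t^x(Z\circ\theta_t)=\rho^{X_t}(Z)$ $\mathbb{P}^x$-a.s., where $\rho^{X_t}(Z)$ is $\omega\mapsto\rho^{X_t(\omega)}(Z)$. Time consistency: $\varrho$ is time consistent if for all $Y,Z\in b\mathcal{F}$, $t\in\mathbb{N}_0$, $x\in E$: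 $\rho^x_{t+1}(Y)\le\rho^x_{t+1}(Z)$ $\mathbb{P}^x$-a.s. implies $\rho^x_t(Y)\le\rho^x_t(Z)$ $\mathbb{P}^x$-a.s. Extended space. Let $\tilde\Omega=(\mathbb{R}\times\mathbb{R})^{\mathbb{N}_0}$ with canonical process $(X_t(\tilde\omega),M_t(\tilde\omega))=\tilde\omega(t)$, $\tilde{\mathcal{F}}_t=\sigma((X_s,M_s):s\le t)$, $\tilde{\mathcal{F}}=\sigma(\bigcup_t\tilde{\mathcal{F}}_t)$, and let $\tilde{\mathbb{P}}^{x,m}$ be the unique probability measure on $(\tilde\Omega,\tilde{\mathcal{F}})$ under which $(X,M)$ is a time-homogeneous Markov chain with $\tilde{\mathbb{P}}^{x,m}(X_0=x,M_0=m)=1$ and transition kernel $q^{X,M}(\mathrm{d}x',\mathrm{d}m'\vert x,m)=\delta_{m\vee x'}(\mathrm{d}m')\,q^X(\mathrm{d}x'\vert x)$. For bounded measurable $f$ on $(\mathbb{R}\times\mathbb{R})^{\mathbb{N}_0}$ define the (regular) collection of risk mappings $$\rho^{x,m}(f(X_0,M_0,X_1,M_1,\ldots)):=\rho^x(f(X_0,m,X_1,X_1^*\vee m,X_2,X_2^*\vee m,\ldots)).$$ *)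

(* Defs.v *)
(* Built on MathComp-Analysis. *)
From HB Require Import structures.
From mathcomp Require Import all_boot all_order all_algebra.
From mathcomp Require Import all_classical all_reals all_analysis.

Set Implicit Arguments.
Unset Strict Implicit.
Unset Printing Implicit Defensive.
Import Order.TTheory GRing.Theory Num.Theory.
Import numFieldNormedType.Exports.

Local Open Scope classical_set_scope.
Local Open Scope ring_scope.

(* The path space is defined over an arbitrary measurable state space [E]: it is
   used with E = R (paths of X) and with E = R * R (paths of (X, M)).  Every
   filtration type below is convertible to [nat -> E], so a path [w] can be
   applied: [w t] is the value at time [t] of the canonical process. *)

Definition filt_gen d (E : measurableType d) (t : nat) : set (set (nat -> E)) :=
  \bigcup_(s in [set s | (s <= t)%N])
    preimage_set_system setT (fun w : nat -> E => w s) measurable.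
Arguments filt_gen {d} E t.

(* the path space, measurable with respect to F_t = <<s filt_gen E t >> *)
Definition filt_space d (E : measurableType d) (t : nat) :=
  g_sigma_algebraType (filt_gen E t).
Arguments filt_space {d} E t.

(* the path space, measurable with respect to F = sigma (\bigcup_t F_t) *)
Definition path_space d (E : measurableType d) :=
  g_sigma_algebraType (\bigcup_t <<s filt_gen E t >>).
Arguments path_space {d} E.

Definition shift (E : Type) (t : nat) (w : nat -> E) : nat -> E :=
  fun s => w (t + s)%N.

Definition bmeas (R : realType) d (T : measurableType d) (Z : T -> R) : Prop :=
  measurable_fun [set: T] Z /\ bounded_fun Z.

(* the bounded F_t-measurable random variables *)
Definition bmeas_at (R : realType) d (E : measurableType d) (t : nat)
    (Z : path_space E -> R) : Prop :=
  bmeas (Z : filt_space E t -> R).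

Definition stopping_time d (E : measurableType d) (T : nat)
    (tau : path_space E -> nat) : Prop :=
  (forall w, (tau w <= T)%N) /\
  (forall t, <<s filt_gen E t >> [set w | (tau w <= t)%N]).

(* [P x (A `&` [set w | B (w t.+1)])] is computed from the one-step kernel
   q (B | y) = P y (X_1 \in B). *)
Definition markov_chain (R : realType) (P : R.-pker R ~> path_space R) : Prop :=
  (forall x, P x [set w | w 0%N = x] = 1%E) /\
  (forall x t (A : set (path_space R)) (B : set R),
     <<s filt_gen R t >> A -> measurable B ->
     P x (A `&` [set w | B (w t.+1)]) =
     (\int[P x]_(w in A) P (w t) [set w' | B (w' 1%N)])%E).

(* Functionals on bounded measurable random variables are represented by total
   functions on all real functions on the path space; only their restriction
   to the bounded measurable ones is constrained. *)

Definition risk_mapping (R : realType)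
    (P : {measure set (path_space R) -> \bar R})
    (rho : (path_space R -> R) -> R) : Prop :=
  [/\ rho (fun=> 0) = 0,
      forall (Z : path_space R -> R) (c : R), bmeas Z ->
        rho (fun w => Z w + c) = c + rho Z
    & forall Z Z' : path_space R -> R, bmeas Z -> bmeas Z' ->
        {ae P, forall w, Z w <= Z' w} -> rho Z <= rho Z'].

Definition cond_risk_mapping (R : realType)
    (P : {measure set (path_space R) -> \bar R}) (t : nat)
    (rho : (path_space R -> R) -> path_space R -> R) : Prop :=
  [/\ forall Z : path_space R -> R, bmeas Z -> bmeas_at t (rho Z),
      {ae P, forall w, rho (fun=> 0) w = 0},
      forall Z Z' : path_space R -> R, bmeas Z -> bmeas_at t Z' ->
        {ae P, forall w, rho (fun w' => Z w' + Z' w') w = Z' w + rho Z w}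
    & forall Z Z' : path_space R -> R, bmeas Z -> bmeas Z' ->
        {ae P, forall w, Z w <= Z' w} ->
        {ae P, forall w, rho Z w <= rho Z' w}].

(* A sequence (rho_t)_t whose member of index 0 is real-valued.
   [cond_risk r 0] is irrelevant. *)
Record risk_sequence (R : realType) := RiskSequence {
  risk : (path_space R -> R) -> R ;
  cond_risk : nat -> (path_space R -> R) -> path_space R -> R }.

(* rho_t (Z) as a random variable, constant for t = 0 *)
Definition risk_at (R : realType) (r : risk_sequence R) (t : nat)
    (Z : path_space R -> R) : path_space R -> R :=
  if t is 0%N then fun=> risk r Z else cond_risk r t Z.

Definition dynamic_risk_mapping (R : realType)
    (P : {measure set (path_space R) -> \bar R}) (r : risk_sequence R) : Prop :=
  risk_mapping P (risk r) /\
  (forall t, (0 < t)%N -> cond_risk_mapping P t (cond_risk r t)).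

(* [E] is the set of starting points, and also the state space of the paths. *)
Definition regular (R : realType) d (E : measurableType d)
    (rho : E -> (path_space E -> R) -> R) : Prop :=
  forall Z : path_space E -> R, bmeas Z -> bmeas (fun x => rho x Z).

Definition risk_markov (R : realType) (P : R.-pker R ~> path_space R)
    (varrho : R -> risk_sequence R) : Prop :=
  regular (fun x => risk (varrho x)) /\
  (forall (x : R) (Z : path_space R -> R) (t : nat), bmeas Z ->
     {ae P x, forall w, risk_at (varrho x) t (fun w' => Z (shift t w')) w =
                        risk (varrho (w t)) Z}).

Definition time_consistent (R : realType) (P : R.-pker R ~> path_space R)
    (varrho : R -> risk_sequence R) : Prop :=
  forall (Y Z : path_space R -> R) (t : nat) (x : R), bmeas Y -> bmeas Z ->
    {ae P x, forall w, risk_at (varrho x) t.+1 Y w <=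
                       risk_at (varrho x) t.+1 Z w} ->
    {ae P x, forall w, risk_at (varrho x) t Y w <= risk_at (varrho x) t Z w}.

(* X*_n = max_(0 <= s <= n) X_s *)
Definition run_max (R : realType) (n : nat) (w : path_space R) : R :=
  \big[Num.max/w 0%N]_(s < n.+1) w s.

(* (X_0, m), (X_1, X*_1 \/ m), (X_2, X*_2 \/ m), ... : the second component is
   [m] itself at time 0, and X_0 enters the maximum from time 1 on. *)
Definition extend (R : realType) (m : R) (w : path_space R) :
    path_space (R * R)%type :=
  fun t => (w t, if t is 0%N then m else Num.max (run_max t w) m).

(* rho^(x, m).  That this collection is regular, i.e. jointly measurable in
   (x, m), is part of its definition in the source; it is not implied by
   regularity of x |-> rho^x, because (x, m) |-> rho^x (F m) with F jointly
   measurable need not be measurable for a nonlinear rho^x. *)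
Definition ext_risk (R : realType) (varrho : R -> risk_sequence R)
    (p : R * R) (f : path_space (R * R)%type -> R) : R :=
  risk (varrho p.1) (fun w => f (extend p.2 w)).

Definition ext_value (R : realType) (varrho : R -> risk_sequence R) (g : R -> R)
    (T : nat) (p : R * R) : R :=
  inf [set ext_risk varrho p (fun w => g ((w T).2 - (w (tau w)).1))
      | tau in stopping_time (E := (R * R)%type) T].

Definition pred_value (R : realType) (varrho : R -> risk_sequence R)
    (g : R -> R) (n : nat) (x : R) : R :=
  inf [set risk (varrho x) (fun w => g (run_max n w - w (tau w)))
      | tau in stopping_time (E := R) n].

(* Main.v *)
(* Applying rho^(x,m) to a shifted variable F o theta_1 is the same as applying it
   to rho^(X_1,M_1)(F): the Markov property computes rho_1 of the shifted
   variable, and time consistency brings the equality back to time 0.  By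
   induction on the horizon n this yields one stopping time that is optimal for
   all starting points (x, m) at once: stop on the measurable set where stopping
   costs no more than continuing, otherwise follow the optimal time of the
   shifted path.  Conversely, F_0 only sees the starting point, so any stopping
   time either stops at once or is 1 plus a stopping time of the shifted path;
   hence it cannot beat the minimum.  No measurable selection is required. *)
Require Import Defs.
From HB Require Import structures.
From mathcomp Require Import all_boot all_order all_algebra.
From mathcomp Require Import all_classical all_reals all_analysis.
From mathcomp Require Import measurable_realfun.
Set Implicit Arguments.
Unset Strict Implicit.
Unset Printing Implicit Defensive.
Import Order.TTheory GRing.Theory Num.Theory.
Import numFieldNormedType.Exports.
Local Open Scope classical_set_scope.
Local Open Scope ring_scope.

(** * Measurability on path space *)

Section PathMeasurability.
Context d (E : measurableType d).

Lemma measurable_coord (s t : nat) : (s <= t)%N ->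
  measurable_fun setT (fun w : filt_space E t => w s).
Proof.
move=> st _ B mB; apply: sub_sigma_algebra.
by exists s => //; exists B.
Qed.

Lemma measurable_to_filt d' (T : measurableType d') (t : nat)
    (f : T -> nat -> E) :
  (forall s, (s <= t)%N -> measurable_fun setT (fun x => f x s)) ->
  measurable_fun setT (f : T -> filt_space E t).
Proof.
move=> mf; apply: (@measurability _ _ _ (filt_space E t) _ _ (filt_gen E t)) => //.
move=> _ [_ [s st [B mB <-]] <-].
by rewrite !setTI; have := mf s st measurableT B mB; rewrite setTI.
Qed.

Lemma measurable_to_path d' (T : measurableType d') (f : T -> nat -> E) :
  (forall s, measurable_fun setT (fun x => f x s)) ->
  measurable_fun setT (f : T -> path_space E).
Proof.
move=> mf; apply: (@measurability _ _ _ (path_space E) _ _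
  (\bigcup_t <<s filt_gen E t >>)) => //.
move=> _ [A [t _ mA] <-].
exact: (@measurable_to_filt _ _ t f (fun s _ => mf s)).
Qed.

Lemma filt_measurable (t : nat) (A : set (nat -> E)) :
  <<s filt_gen E t >> A -> measurable (A : set (path_space E)).
Proof. by move=> mA; apply: sub_sigma_algebra; exists t. Qed.

Lemma measurable_path_coord (s : nat) :
  measurable_fun setT (fun w : path_space E => w s).
Proof.
move=> _ B mB; apply: (@filt_measurable s).
exact: (@measurable_coord s s (leqnn s)).
Qed.

Lemma measurable_shift (t : nat) :
  measurable_fun setT (Defs.shift t : path_space E -> path_space E).
Proof. by apply: measurable_to_path => s; exact: measurable_path_coord. Qed.

(** The sets that cannot separate two paths with the same starting point form a sigma-algebra
    containing the generators of [F_0]. *)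
Lemma filt0_determined (A : set (nat -> E)) (w w' : nat -> E) :
  <<s filt_gen E 0 >> A -> w 0%N = w' 0%N -> A w -> A w'.
Proof.
pose C : set (set (nat -> E)) :=
  [set B | forall u v : nat -> E, u 0%N = v 0%N -> B u -> B v].
suff sub : <<s filt_gen E 0 >> `<=` C by move=> /sub; apply.
apply: smallest_sub; first split.
- by [].
- by move=> B CB u v uv [_ nBu]; split=> // /(CB _ _ (esym uv)).
- by move=> F CF u v uv [k _ Fu]; exists k => //; exact: CF uv Fu.
by move=> _ [[|//] _ [B mB <-]] u v uv [_ Bu]; split=> //=; rewrite -uv.
Qed.

End PathMeasurability.

(** * Constructions of stopping times *)

Section StoppingTimes.
Context d (E : measurableType d).

(** [tau] takes countably many values, so the preimage splits over the events [tau = k]. *)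
Lemma measurable_sampled (T : nat) (tau : path_space E -> nat) :
  stopping_time T tau -> measurable_fun setT (fun w : path_space E => w (tau w)).
Proof.
move=> [_ mtau] _ B mB.
have mle k : measurable [set w : path_space E | (tau w <= k)%N].
  exact: filt_measurable (mtau k).
have meq k : measurable [set w : path_space E | tau w = k].
  case: k => [|k].
    rewrite (_ : [set _ | _] = [set w | (tau w <= 0)%N]) //.
    by apply/seteqP; split=> w /=; [move=> ->|rewrite leqn0 => /eqP].
  rewrite (_ : [set _ | _] =
    [set w | (tau w <= k.+1)%N] `\` [set w | (tau w <= k)%N]).
    exact: measurableD.
  apply/seteqP; split=> w /=.
    by move=> ->; split=> //; apply/negP; rewrite -ltnNge.
  by move=> [le1 /negP]; rewrite -ltnNge => lt2; apply/eqP; rewrite eqn_leq le1.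
rewrite setTI (_ : _ @^-1` B =
    \bigcup_k ([set w : path_space E | tau w = k] `&` (fun w => w k) @^-1` B)).
  apply: bigcup_measurable => k _; apply: measurableI => //.
  by have := @measurable_path_coord d E k measurableT _ mB; rewrite setTI.
apply/seteqP; split=> [w Bw|w [k _ [<-]]//].
by exists (tau w).
Qed.

(** Adaptedness of [f] suffices; this carries stopping times between paths of [X] and of
    [(X, M)]. *)
Lemma stopping_time_comp d' (E' : measurableType d') (T : nat)
    (f : (nat -> E) -> nat -> E') (tau : path_space E' -> nat) :
  (forall t, measurable_fun setT (f : filt_space E t -> filt_space E' t)) ->
  stopping_time T tau -> stopping_time T (fun w : path_space E => tau (f w)).
Proof.
move=> mf [leT mtau]; split=> [w|t]; first exact: leT.
by have := mf t measurableT _ (mtau t); rewrite setTI.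
Qed.

Lemma stopping_time0 : stopping_time 0 (fun _ : path_space E => 0%N).
Proof.
split=> // t; rewrite (_ : [set _ | _] = setT); last by apply/seteqP; split.
exact: (@measurableT _ (filt_space E t)).
Qed.

Definition path_cons (p : E) (w : nat -> E) : nat -> E :=
  fun t => if t is s.+1 then w s else p.

(** Coordinates up to [t.+1] of the prepended path involve only coordinates up to [t] of [w]. *)
Lemma stopping_time_prefix (T : nat) (p : E) (tau : path_space E -> nat) :
  stopping_time T.+1 tau ->
  stopping_time T (fun w : path_space E => (tau (path_cons p w)).-1).
Proof.
move=> [leT mtau]; split=> [w|t].
  by move: (leT (path_cons p w)); case: (tau _).
have mp : measurable_fun setT
    (path_cons p : filt_space E t -> filt_space E t.+1).
  apply: measurable_to_filt => -[_|s st]; first exact: measurable_cst.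
  exact: measurable_coord.
have := mp measurableT _ (mtau t.+1); rewrite setTI.
(* The convention [0.-1 = 0] does no harm: [k.-1 <= t] and [k <= t.+1] are equivalent for every
   [k]. *)
rewrite (_ : _ @^-1` _ = [set w | ((tau (path_cons p w)).-1 <= t)%N]) //.
by apply/seteqP; split=> w /=; case: (tau _).
Qed.

(** The form of an optimal rule with one more period: [D] will be the set where stopping costs no
    more than continuing. *)
Lemma stopping_time_delay (T : nat) (D : set E) (tau : path_space E -> nat) :
  measurable D -> stopping_time T tau ->
  stopping_time T.+1
    (fun w : path_space E =>
       if w 0%N \in D then 0%N else (tau (Defs.shift 1 w)).+1).
Proof.
move=> mD [leT mtau]; split=> [w|t].
  by case: ifP => // _; exact: leT.
pose C0 : set (filt_space E t) := (fun w => w 0%N) @^-1` D.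
have mC0 : measurable C0.
  by have := @measurable_coord d E 0 t (leq0n t) measurableT _ mD; rewrite setTI.
(* A time of the form [k.+1] is never at most 0, hence the empty set for [t = 0]. *)
pose C1 : set (filt_space E t) :=
  if t is s.+1 then Defs.shift 1 @^-1` [set w | (tau w <= s)%N] else set0.
have mC1 : measurable C1.
  rewrite /C1; case: (t) => [|s]; first exact: measurable0.
  have ms : measurable_fun setT
      (Defs.shift 1 : filt_space E s.+1 -> filt_space E s).
    by apply: measurable_to_filt => r rs; exact: measurable_coord.
  by have := ms measurableT _ (mtau s); rewrite setTI.
rewrite (_ : [set _ | _] = C0 `|` C1).
  exact: (@measurableU _ (filt_space E t) C0 C1).
apply/seteqP; split=> w; rewrite /C0 /C1 /=.
  case: ifPn => [/set_mem|_]; first by left.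
  by case: (t) => [//|s]; right.
case: ifPn => [//|/negP wD] [/mem_set//|].
by case: (t).
Qed.

End StoppingTimes.

(** * The running maximum and the extended path *)

Section RunningMaximum.
Context (R : realType).
Implicit Types (w : nat -> R) (m z : R) (n : nat).

Lemma run_max_leP n w z :
  reflect (forall s, (s <= n)%N -> w s <= z) (run_max n w <= z).
Proof.
apply: (iffP (@bigmax_leP _ _ _ _ _ _ _)) => [[w0 ws] s sn|ws].
  by have := ws (Ordinal (sn : (s < n.+1)%N)) isT.
by split=> [|[s sn] _ /=]; exact: ws.
Qed.

Lemma le_run_max n w s : (s <= n)%N -> w s <= run_max n w.
Proof. by move/run_max_leP: (lexx (run_max n w)); apply. Qed.

Lemma run_max0 w : run_max 0 w = w 0%N.
Proof.
apply/le_anti/andP; split; last exact: le_run_max.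
by apply/run_max_leP => -[].
Qed.

Lemma run_maxS n w : run_max n.+1 w = Num.max (run_max n w) (w n.+1).
Proof.
apply/le_anti/andP; split.
  apply/run_max_leP => s; rewrite leq_eqVlt => /orP[/eqP ->|sn].
    by rewrite le_max lexx orbT.
  by rewrite le_max le_run_max.
rewrite ge_max le_run_max ?andbT//.
by apply/run_max_leP => s sn; apply: le_run_max; exact: leqW.
Qed.

Lemma run_max_shift n w :
  run_max n.+1 w = Num.max (w 0%N) (run_max n (Defs.shift 1 w)).
Proof.
elim: n => [|n IH]; first by rewrite run_maxS !run_max0.
by rewrite run_maxS IH run_maxS maxA.
Qed.

(** The shifted path no longer sees [X_0], so its initial maximum has to carry it; that initial
    maximum is [M_1]. *)
Lemma shift_extend m w : Defs.shift 1 (extend m w) =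
  extend (Num.max (Num.max (w 0%N) (w 1%N)) m) (Defs.shift 1 w).
Proof.
apply/funext => -[|s]; rewrite /Defs.shift /extend !add1n.
  by rewrite run_maxS run_max0.
(* [w 1] enters the right side twice, through the initial maximum and through the shifted path; [h]
   absorbs one copy. *)
have h : w 1%N <= run_max s.+1 (Defs.shift 1 w) by exact: (@le_run_max _ _ 0%N).
congr (_, _); rewrite run_max_shift -/(Defs.shift 1 w) !maxA; congr Num.max.
by rewrite -(maxC (w 0%N)) -maxA; congr Num.max; rewrite (max_idPl h).
Qed.

Lemma extend1 m w :
  extend m w 1 = (w 1%N, Num.max (Num.max (w 0%N) (w 1%N)) m).
Proof. by rewrite /extend run_maxS run_max0. Qed.

Lemma extend_snd_diag n w : (extend (w 0%N) w n).2 = run_max n w.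
Proof.
case: n => [|n] /=; first by rewrite run_max0.
by apply/max_idPl; exact: le_run_max.
Qed.

Lemma measurable_run_max d (T : measurableType d) (X : T -> nat -> R) n :
  (forall s, (s <= n)%N -> measurable_fun setT (fun x => X x s)) ->
  measurable_fun setT (fun x => run_max n (X x)).
Proof.
elim: n => [|n IH] mX.
  by under eq_fun do rewrite run_max0; exact: mX.
under eq_fun do rewrite run_maxS.
by apply: measurable_maxr; [apply: IH => s /leqW; exact: mX|exact: mX].
Qed.

(** [M] may vary with [x], because a shifted path is extended by a random initial maximum. *)
Lemma measurable_extend_coord d (T : measurableType d) (M : T -> R)
    (X : T -> nat -> R) n :
  measurable_fun setT M ->
  (forall s, (s <= n)%N -> measurable_fun setT (fun x => X x s)) ->
  measurable_fun setT (fun x => extend (M x) (X x) n).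
Proof.
move=> mM mX; apply: measurable_fun_pair; first exact: mX.
case: n mX => [//|n] mX.
by apply: measurable_maxr => //; exact: measurable_run_max.
Qed.

Lemma measurable_extend d (T : measurableType d) (M : T -> R)
    (X : T -> path_space R) :
  measurable_fun setT M -> measurable_fun setT X ->
  measurable_fun setT
    ((fun x => extend (M x) (X x)) : T -> path_space (R * R)%type).
Proof.
move=> mM mX; apply: measurable_to_path => s.
apply: measurable_extend_coord => // r _.
exact: (measurableT_comp (@measurable_path_coord _ _ r)).
Qed.

Lemma measurable_extend_filt m t :
  measurable_fun setT
    (extend m : filt_space R t -> filt_space (R * R)%type t).
Proof.
apply: measurable_to_filt => s st.
apply: measurable_extend_coord => // r rs.
by apply: measurable_coord; exact: leq_trans st.
Qed.

End RunningMaximum.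

(** * Bounded measurable functions *)

Lemma bmeas_comp (R : realType) d d' (T : measurableType d)
    (T' : measurableType d') (Z : T -> R) (f : T' -> T) :
  bmeas Z -> measurable_fun setT f -> bmeas (fun x => Z (f x)).
Proof.
move=> [mZ bZ] mf; split; first exact: measurableT_comp.
by case: bZ => M [Mreal bM]; exists M; split=> // N /bM bN x _; exact: bN.
Qed.

Lemma bmeas_cst (R : realType) d (T : measurableType d) (c : R) :
  bmeas (fun _ : T => c).
Proof.
split; first exact: measurable_cst.
by exists `|c|; split => [|M /ltW cM x _ //]; exact: num_real.
Qed.

(** * Risk mappings under [P x] *)

Section DynamicRisk.
Context (R : realType) (P : R.-pker R ~> path_space R).
Context (varrho : R -> risk_sequence R).
Context (chainP : markov_chain P).
Context (dynrho : forall x : R, dynamic_risk_mapping (P x) (varrho x)).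

Lemma prob_setT x : P x setT = 1%E.
Proof. exact: prob_kernel. Qed.

Lemma ae_start x : {ae P x, forall w, w 0%N = x}.
Proof.
have mA : measurable [set w : path_space R | w 0%N = x].
  have := @measurable_path_coord _ R 0 measurableT _ (measurable_set1 x).
  by rewrite setTI.
exists (~` [set w : path_space R | w 0%N = x]); split=> //.
  exact: measurableC.
have fin : (P x setT < +oo)%E by rewrite prob_setT ltry.
have := @measureD _ _ _ (P x) setT _ measurableT mA fin.
rewrite setTD setTI => ->; rewrite -(@subee _ 1%E) //.
by congr (_ - _)%E; [exact: prob_setT|exact: chainP.1].
Qed.

#[local] Instance ae_filter_kernel x : Filter (almost_everywhere (P x)).
Proof. exact: ae_filter_ringOfSetsType. Qed.

(** [P x] has positive mass, so its almost-everywhere filter is proper. This turns almost sure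
    inequalities between time-0 risks, which are constants, into plain ones. *)
Lemma ae_cst x (Q : Prop) : {ae P x, forall w : path_space R, Q} -> Q.
Proof.
move=> aeQ; have PT : (0 < P x setT)%E by rewrite prob_setT lte01.
by have [] := @filter_ex _ _ (ae_properfilter_algebraOfSetsType PT) _ aeQ.
Qed.

(** [P x] is carried by the paths starting at [x], so monotonicity needs the comparison on those
    only. *)
Lemma le_risk x (Z Z' : path_space R -> R) : bmeas Z -> bmeas Z' ->
  (forall w : path_space R, w 0%N = x -> Z w <= Z' w) ->
  risk (varrho x) Z <= risk (varrho x) Z'.
Proof.
move=> bZ bZ' ZZ'; have [[_ _ mono] _] := dynrho x.
by apply: mono => //; apply: filterS (ae_start x) => w; exact: ZZ'.
Qed.

Lemma eq_risk x (Z Z' : path_space R -> R) : bmeas Z -> bmeas Z' ->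
  (forall w : path_space R, w 0%N = x -> Z w = Z' w) ->
  risk (varrho x) Z = risk (varrho x) Z'.
Proof.
move=> bZ bZ' ZZ'.
by apply/le_anti/andP; split; apply: le_risk => // w /ZZ' ->.
Qed.

Lemma risk_cst x c : risk (varrho x) (fun=> c) = c.
Proof.
have [[rho0 cash _] _] := dynrho x.
by have := cash (fun=> 0) c (bmeas_cst _ _); rewrite add0r rho0 addr0.
Qed.

Lemma bmeas_extend m (F : path_space (R * R)%type -> R) :
  bmeas F -> bmeas (fun w : path_space R => F (extend m w)).
Proof.
move=> bF; apply: (bmeas_comp bF).
by apply: (@measurable_extend _ _ _ (fun=> m) id); [exact: measurable_cst|].
Qed.

Lemma le_ext_risk p (F G : path_space (R * R)%type -> R) : bmeas F -> bmeas G ->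
  (forall w : path_space (R * R)%type, w 0%N = p -> F w <= G w) ->
  ext_risk varrho p F <= ext_risk varrho p G.
Proof.
case: p => x m bF bG FG; apply: le_risk => [||w wx]; first 1 last.
- exact: bmeas_extend.
- by apply: FG; rewrite /extend wx.
exact: bmeas_extend.
Qed.

Lemma eq_ext_risk p (F G : path_space (R * R)%type -> R) : bmeas F -> bmeas G ->
  (forall w : path_space (R * R)%type, w 0%N = p -> F w = G w) ->
  ext_risk varrho p F = ext_risk varrho p G.
Proof.
move=> bF bG FG.
by apply/le_anti/andP; split; apply: le_ext_risk => // w /FG ->.
Qed.

(** * One step of the Markov property and time consistency *)

Context (markovrho : risk_markov P varrho).
Context (regularrho : regular (ext_risk varrho)).
Context (consistentrho : time_consistent P varrho).

Lemma bmeas_ext_risk1 (F : path_space (R * R)%type -> R) : bmeas F ->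
  bmeas (fun w : path_space (R * R)%type => ext_risk varrho (w 1%N) F).
Proof.
move=> bF; apply: (bmeas_comp (regularrho bF)).
exact: measurable_path_coord.
Qed.

(* Given X_0 = x, the shifted extended path is the extension of the shifted path
   by M_1, so the Markov property identifies rho_1 of the shifted variable with
   rho^(X_1, M_1)(F); time consistency transfers the equality to time 0. *)
Lemma ext_risk_shift p (F : path_space (R * R)%type -> R) : bmeas F ->
  ext_risk varrho p (fun w => F (Defs.shift 1 w)) =
  ext_risk varrho p (fun w => ext_risk varrho (w 1%N) F).
Proof.
case: p => x m bF; rewrite {1 2}/ext_risk /=.
pose Z (w : path_space R) := F (Defs.shift 1 (extend m w)).
pose U (w : path_space R) := ext_risk varrho (extend m w 1%N) F.
(* The Markov property needs a variable of the form [H] after the shift. [H] replaces [X_0] by the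
   constant [x], and its own [w 0] stands for [X_1]. *)
pose H (w : path_space R) := F (extend (Num.max (Num.max x (w 0%N)) m) w).
have bZ : bmeas Z.
  by apply: (@bmeas_extend _ (fun w => F (Defs.shift 1 w)));
    apply: (bmeas_comp bF); exact: measurable_shift.
have bU : bmeas U by exact: (bmeas_extend _ (bmeas_ext_risk1 bF)).
have bU1 : bmeas_at 1 U.
  apply: (@bmeas_comp _ _ _ _ (filt_space R 1) _ (fun w => extend m w 1%N)
    (regularrho bF)).
  by apply: measurable_extend_coord => [|s s1];
    [exact: measurable_cst|exact: measurable_coord].
have bH : bmeas H.
  apply: (bmeas_comp bF); apply: (@measurable_extend _ _ _ _ id) => //.
  apply: measurable_maxr; last exact: measurable_cst.
  by apply: measurable_maxr; [exact: measurable_cst|exact: measurable_path_coord].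
have bHs : bmeas (fun w : path_space R => H (Defs.shift 1 w)).
  by apply: (bmeas_comp bH); exact: measurable_shift.
have ZH : {ae P x, forall w, Z w = H (Defs.shift 1 w)}.
  by apply: filterS (ae_start x) => w wx; rewrite /Z shift_extend wx.
have [_ /(_ 1%N isT)[_ rho0 cash mono]] := dynrho x.
(* Translation by the [F_1]-measurable [U], applied to the zero variable. *)
have rU : {ae P x, forall w, cond_risk (varrho x) 1 U w = U w}.
  have := cash _ _ (bmeas_cst _ 0) bU1.
  rewrite (_ : (fun w => 0 + U w) = U); last by apply/funext => w; rewrite add0r.
  by apply: filterS2 rho0 => w -> ->; rewrite addr0.
have rZ : {ae P x, forall w, cond_risk (varrho x) 1 Z w = U w}.
  have le1 : {ae P x, forall w, cond_risk (varrho x) 1 Z w <=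
      cond_risk (varrho x) 1 (fun w' => H (Defs.shift 1 w')) w}.
    by apply: mono => //; apply: filterS ZH => w ->.
  have le2 : {ae P x, forall w,
      cond_risk (varrho x) 1 (fun w' => H (Defs.shift 1 w')) w <=
      cond_risk (varrho x) 1 Z w}.
    by apply: mono => //; apply: filterS ZH => w ->.
  have mk := markovrho.2 x H 1%N bH.
  have : {ae P x, forall w, cond_risk (varrho x) 1 Z w =
      risk (varrho (w 1%N)) H}.
    by apply: filterS3 le1 le2 mk => w le1 le2 <-; apply/le_anti; rewrite le1.
  (* Under [rho^(X_1)] paths start at [X_1], so the initial maximum inside [H] may be frozen at
     [M_1]. *)
  apply: filterS2 (ae_start x) => w wx ->; rewrite /U extend1 wx /ext_risk /=.
  apply: eq_risk => // [|w' w'0]; first exact: bmeas_extend.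
  by rewrite /H w'0.
apply/le_anti/andP; split; apply: (@ae_cst x).
  apply: (consistentrho (t := 0%N) bZ bU).
  by apply: filterS2 rU rZ => w /= -> ->.
apply: (consistentrho (t := 0%N) bU bZ).
by apply: filterS2 rU rZ => w /= -> ->.
Qed.

(** * Dynamic programming for the extended problem *)

Context (g : R -> R) (bmeasg : bmeas g).

Definition payoff n (tau : path_space (R * R)%type -> nat)
  (w : path_space (R * R)%type) : R := g ((w n).2 - (w (tau w)).1).

Lemma bmeas_payoff n T tau : stopping_time T tau -> bmeas (payoff n tau).
Proof.
move=> /measurable_sampled mtau; apply: (bmeas_comp bmeasg).
by apply: measurable_funB; apply: measurableT_comp => //;
  exact: measurable_path_coord.
Qed.

(** One time serves all [p]: it is later run on a shifted path, whose starting point [(X_1, M_1)] is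
    random. *)
Definition optimal n tau := stopping_time n tau /\
  forall p sigma, stopping_time n sigma ->
    ext_risk varrho p (payoff n tau) <= ext_risk varrho p (payoff n sigma).

(** The risk of [tau] is both a member and a lower bound of the set, so the real-valued [inf] is a
    genuine infimum. *)
Lemma ext_value_optimal n tau p : optimal n tau ->
  ext_value varrho g n p = ext_risk varrho p (payoff n tau).
Proof.
move=> [st opt]; apply/le_anti/andP; split.
  apply: ge_inf; last by exists tau.
  by exists (ext_risk varrho p (payoff n tau)) => _ [sigma ss <-]; exact: opt.
apply: lb_le_inf; first by exists (ext_risk varrho p (payoff n tau)), tau.
by move=> _ [sigma ss <-]; exact: opt.
Qed.

Lemma optimal0 : optimal 0 (fun=> 0%N).
Proof.
split; first exact: stopping_time0.
move=> p sigma ss; rewrite (_ : sigma = fun=> 0%N) //.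
by apply/funext => w; apply/eqP; rewrite -leqn0; exact: ss.1.
Qed.

Definition stop_risk n (p : R * R) :=
  ext_risk varrho p (fun w => g ((w n).2 - p.1)).

Definition continue_risk n tau (p : R * R) :=
  ext_risk varrho p (fun w => ext_risk varrho (w 1%N) (payoff n tau)).

Lemma stop_riskE n p :
  stop_risk n p = ext_risk varrho p (payoff n (fun=> 0%N)).
Proof.
apply: eq_ext_risk => [||w <-//]; last exact: (bmeas_payoff _ (stopping_time0 _)).
apply: (bmeas_comp bmeasg).
by apply: measurable_funB; [apply: measurableT_comp => //;
  exact: measurable_path_coord|exact: measurable_cst].
Qed.

Lemma continue_riskE n tau p : stopping_time n tau ->
  continue_risk n tau p =
  ext_risk varrho p (fun w => payoff n tau (Defs.shift 1 w)).
Proof. by move=> st; rewrite ext_risk_shift //; exact: bmeas_payoff st. Qed.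

Lemma bmeas_payoff_shift n tau : stopping_time n tau ->
  bmeas (fun w : path_space (R * R)%type => payoff n tau (Defs.shift 1 w)).
Proof.
move=> st; apply: (bmeas_comp (bmeas_payoff n st)).
exact: measurable_shift.
Qed.

Lemma min_le_payoff n tau p sigma : optimal n tau -> stopping_time n.+1 sigma ->
  Num.min (stop_risk n.+1 p) (continue_risk n tau p) <=
  ext_risk varrho p (payoff n.+1 sigma).
Proof.
move=> [st opt] ss.
have s0 (w w' : path_space (R * R)%type) : w 0%N = w' 0%N ->
    sigma w = 0%N -> sigma w' = 0%N.
  move=> ww' w0; apply/eqP; rewrite -leqn0.
  by apply: (filt0_determined (ss.2 0%N) ww'); rewrite /= w0.
rewrite ge_min; apply/orP.
(* By [s0] the constant path at [p] decides for every path from [p] whether [sigma] stops at time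
   0. *)
have [p0|p0] := eqVneq (sigma (fun=> p)) 0%N; [left|right].
  rewrite stop_riskE le_eqVlt; apply/orP; left; apply/eqP.
  apply: eq_ext_risk => [||w wp].
  - exact: (bmeas_payoff _ (stopping_time0 _)).
  - exact: bmeas_payoff ss.
  - by rewrite /payoff (s0 (fun=> p)).
have sp := stopping_time_prefix p ss.
set sigma' := (fun w => _) in sp.
(* [tau] beats [sigma'] from every possible [(X_1, M_1)]; outer monotonicity passes this on to time
   0. *)
apply: (@le_trans _ _ (continue_risk n sigma' p)).
  apply: le_ext_risk => [||w _]; last exact: opt.
    exact: (bmeas_ext_risk1 (bmeas_payoff _ st)).
  exact: (bmeas_ext_risk1 (bmeas_payoff _ sp)).
rewrite (continue_riskE _ sp).
apply: le_ext_risk => [||w wp]; first exact: bmeas_payoff_shift.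
  exact: bmeas_payoff ss.
have consw : path_cons p (Defs.shift 1 w) = w by apply/funext => -[|s].
(* On paths from [p], [sigma] is positive, so taking the predecessor and adding 1 back loses
   nothing. *)
rewrite /payoff /sigma' consw /Defs.shift !add1n prednK // lt0n.
by apply/eqP => w0; move/eqP: p0; apply; exact: (s0 w).
Qed.

Lemma exists_min_payoff n tau : optimal n tau ->
  exists2 sigma, stopping_time n.+1 sigma &
    forall p, ext_risk varrho p (payoff n.+1 sigma) =
      Num.min (stop_risk n.+1 p) (continue_risk n tau p).
Proof.
move=> [st _].
pose D := [set p | stop_risk n.+1 p <= continue_risk n tau p].
have mD : measurable D.
  have mle : measurable_fun setT
      (fun p => stop_risk n.+1 p <= continue_risk n tau p).
    apply: measurable_fun_ler.
      (* The variable inside [stop_risk] depends on [p]; regularity applies once it is replaced by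
         one fixed payoff. *)
      rewrite (funext (stop_riskE n.+1)).
      by have [] := regularrho (bmeas_payoff n.+1 (stopping_time0 _)).
    rewrite (funext (fun p => continue_riskE p st)).
    by have [] := regularrho (bmeas_payoff_shift st).
  by have := mle measurableT [set true] I; rewrite setTI.
have sd := stopping_time_delay mD st.
exists (fun w => if w 0%N \in D then 0%N else (tau (Defs.shift 1 w)).+1) => // p.
have [pD|pD] := boolP (p \in D).
  rewrite (min_idPl (set_mem pD)) stop_riskE.
  apply: eq_ext_risk => [||w wp]; first exact: bmeas_payoff sd.
    exact: (bmeas_payoff _ (stopping_time0 _)).
  by rewrite /payoff (_ : w 0%N \in D) ?wp.
have /ltW/min_idPr -> : continue_risk n tau p < stop_risk n.+1 p.
  by rewrite ltNge; apply: contra pD => le; exact/mem_set.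
rewrite (continue_riskE _ st); apply: eq_ext_risk => [||w wp].
- exact: bmeas_payoff sd.
- exact: bmeas_payoff_shift.
by rewrite /payoff wp (negbTE pD) /Defs.shift !add1n.
Qed.

(** The minimum bounds every stopping time from below and is attained, for all [p] by the same
    time. *)
Lemma optimalS n tau : optimal n tau ->
  exists2 sigma, optimal n.+1 sigma &
    forall p, ext_risk varrho p (payoff n.+1 sigma) =
      Num.min (stop_risk n.+1 p) (continue_risk n tau p).
Proof.
move=> ot; have [sigma ss eqmin] := exists_min_payoff ot.
by exists sigma => //; split=> // p sigma' ss'; rewrite eqmin min_le_payoff.
Qed.

Lemma exists_optimal n : exists tau, optimal n tau.
Proof.
elim: n => [|n [tau /optimalS[sigma os _]]]; last by exists sigma.
by exists (fun=> 0%N); exact: optimal0.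
Qed.

Lemma ext_value0 p : ext_value varrho g 0 p = g (p.2 - p.1).
Proof.
rewrite (ext_value_optimal _ optimal0) -[RHS](risk_cst p.1).
have -> : risk (varrho p.1) (fun=> g (p.2 - p.1)) =
    ext_risk varrho p (fun=> g (p.2 - p.1)) by [].
apply: eq_ext_risk => [||w]; last by rewrite /payoff => ->.
  exact: (bmeas_payoff _ (stopping_time0 _)).
exact: bmeas_cst.
Qed.

Lemma ext_valueS n p : ext_value varrho g n.+1 p =
  Num.min (ext_risk varrho p (fun w => g ((w n.+1).2 - p.1)))
          (ext_risk varrho p (fun w => ext_value varrho g n (w 1%N))).
Proof.
have [tau ot] := exists_optimal n.
have [sigma os eqmin] := optimalS ot.
rewrite (ext_value_optimal _ os) eqmin /stop_risk /continue_risk.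
congr (Num.min _ (ext_risk varrho p _)).
by apply/funext => w; rewrite (ext_value_optimal _ ot).
Qed.

(** Both infima range over the same set: forgetting [M] lifts a stopping time of [X], and composing
    with [extend x] brings one back. *)
Lemma pred_valueE n x : pred_value varrho g n x = ext_value varrho g n (x, x).
Proof.
have eq_payoff tau (sigma : path_space R -> nat) :
    stopping_time n tau -> stopping_time n sigma ->
    (forall w, w 0%N = x -> tau (extend x w) = sigma w) ->
    ext_risk varrho (x, x) (payoff n tau) =
    risk (varrho x) (fun w => g (run_max n w - w (sigma w))).
  move=> st /measurable_sampled mw tw; apply: eq_risk => [||w wx].
  - exact: (bmeas_extend _ (bmeas_payoff _ st)).
  - apply: (bmeas_comp bmeasg); apply: measurable_funB => //.
    apply: (@measurable_run_max _ _ _ (fun w : path_space R => w)) => s _.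
    exact: measurable_path_coord.
  - by rewrite /payoff tw // -[x in extend x]wx extend_snd_diag.
congr (inf _); apply/seteqP; split=> _ [tau st <-].
  pose tau' (w : path_space (R * R)%type) := tau (fun s => (w s).1).
  have st' : stopping_time n tau'.
    apply: (@stopping_time_comp _ _ _ _ _ (fun w s => (w s).1)) st => t.
    apply: measurable_to_filt => s st'; apply: measurableT_comp => //.
    exact: measurable_coord.
  by exists tau' => //; exact: eq_payoff.
pose tau' (w : path_space R) := tau (extend x w).
have st' : stopping_time n tau'.
  exact: (stopping_time_comp (measurable_extend_filt x)).
by exists tau' => //; rewrite -(eq_payoff tau).
Qed.

End DynamicRisk.

Theorem theorem5p1 (R : realType) (P : R.-pker R ~> path_space R)
    (varrho : R -> risk_sequence R)
    (chainP : markov_chain P)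
    (dynrho : forall x : R, dynamic_risk_mapping (P x) (varrho x))
    (markovrho : risk_markov P varrho)
    (regularrho : regular (ext_risk varrho))
    (consistentrho : time_consistent P varrho)
    (g : R -> R) (bmeasg : bmeas g) :
  [/\ forall x m : R, ext_value varrho g 0 (x, m) = g (m - x),
      forall (n : nat) (x m : R), (1 <= n)%N ->
        ext_value varrho g n (x, m) =
        Num.min (ext_risk varrho (x, m) (fun w => g ((w n).2 - x)))
                (ext_risk varrho (x, m)
                   (fun w => ext_value varrho g n.-1 ((w 1%N).1, (w 1%N).2)))
    & forall (n : nat) (x : R),
        pred_value varrho g n x = ext_value varrho g n (x, x)].
Proof.
split=> [x m|[//|n] x m _|n x].
- exact: (ext_value0 chainP).
(* [ext_value] reads its pair only through the projections, so the rebuilt pair is accepted by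
   conversion. *)
- exact: (ext_valueS chainP).
- exact: (pred_valueE chainP).
Qed.
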